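(* Let $m\geq 1$ and $0\leq h\leq 2^m-1$ be fixed integers. For each integer $n>m+1$ let $s_n$ be the binary string of length $n$ consisting of the bit $1$, followed by $n-m-1$ bits $0$, followed by the Gray code string $g_{m,h+1}$. Then $$\lim_{n\to\infty}\frac{2^{n+1}}{2h+1}\sqrt{\omega(s_n)}=\pi.$$
   Context: Binary reflected Gray code: for $k\geq 1$, $g_{k,1},\dots,g_{k,2^k}$ are binary strings of length $k$ defined recursively by $g_{1,1}=0$, $g_{1,2}=1$, and for $k\geq 2$: $g_{k,j}=0\,g_{k-1,j}$ (the bit $0$ followed by $g_{k-1,j}$) for $1\leq j\leq 2^{k-1}$, and $g_{k,j}=1\,g_{k-1,2^k+1-j}$ for $2^{k-1}<j\leq 2^k$. For a binary string $b=b_1b_2\cdots b_k$ ($k\geq1$), define the nested radical $$\omega(b)=2+\epsilon_1\sqrt{2+\epsilon_2\sqrt{2+\cdots+\epsilon_k\sqrt{2}}},$$ where $\epsilon_i=+1$ if $b_i=0$ and $\epsilon_i=-1$ if $b_i=1$ (so $\omega(b)$ contains $k$ square roots, the innermost being $\sqrt2$). *)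

(* Defs.v *)
From Stdlib Require Export Reals List Arith.
From Coquelicot Require Export Coquelicot.

(* A binary string is a [list bool], leftmost bit first; [false] is the bit 0
   and [true] the bit 1. *)

(* [gray k j] is the string g_{k,j}, with the index j running from 1 to 2^k as
   in the recursive definition of the reflected code. The values at k = 0 and
   at j outside 1..2^k are junk. *)
Fixpoint gray (k j : nat) {struct k} : list bool :=
  match k with
  | O => nil
  | S O => if Nat.leb j 1 then false :: nil else true :: nil
  | S (S _ as k') =>
      if Nat.leb j (2 ^ k')
      then false :: gray k' j
      else true :: gray k' (2 ^ k + 1 - j)
  end%nat.

Definition eps (b : bool) : R := if b then (-1)%R else 1%R.

(* [omega] of the empty string is 2, the innermost radicand, so that
   [omega (b :: nil)] is 2 + eps b * sqrt 2. *)
Fixpoint omega (b : list bool) : R :=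
  match b with
  | nil => 2%R
  | b1 :: b' => (2 + eps b1 * sqrt (omega b'))%R
  end.

(* The subtraction is truncated, but it is exact (and the string has length n)
   for the relevant indices n > m + 1. *)
Definition gray_tail_string (m h n : nat) : list bool :=
  true :: repeat false (n - m - 1)%nat ++ gray m (h + 1)%nat.

(* Main.v *)
Require Import Defs.
From Stdlib Require Import Lra Lia.
Open Scope R_scope.

(** Write [omega b = (2 cos t)^2] with [0 <= t <= PI / 2].  By the half-angle
    formulas, prefixing the bit 0 replaces [t] by [t / 2], and prefixing the
    bit 1 replaces it by [PI / 2 - t / 2].  The reflection in the Gray code
    matches the second move, so the string g_{m,h+1} has angle
    [(2 h + 1) PI / 2^(m+2)].  Hence [sqrt (omega s_n)] equals
    [2 sin ((2 h + 1) PI / 2^(n+2))], and the limit is that of [sin x / x]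
    at 0. *)

Definition radical_angle (b : list bool) (t : R) : Prop :=
  0 <= t <= PI / 2 /\ omega b = (2 * cos t) ^ 2.

(** The range of [t] in [radical_angle] makes [cos t] nonnegative, so the root of the square carries
    no absolute value. *)
Lemma sqrt_omega_angle (b : list bool) (t : R) :
  radical_angle b t -> sqrt (omega b) = 2 * cos t.
Proof.
  intros [Ht ->]. apply sqrt_pow2.
  assert (0 <= cos t) by (apply cos_ge_0; lra). lra.
Qed.

Lemma radical_angle_nil : radical_angle nil (PI / 4).
Proof.
  pose proof PI_RGT_0. split; [lra|]. cbn [omega].
  pose proof (cos_2a_cos (PI / 4)) as E.
  replace (2 * (PI / 4)) with (PI / 2) in E by field.
  rewrite cos_PI2 in E. nra.
Qed.

Lemma radical_angle_false (b : list bool) (t : R) :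
  radical_angle b t -> radical_angle (false :: b) (t / 2).
Proof.
  intros H. pose proof (sqrt_omega_angle _ _ H) as E. destruct H as [Ht _].
  split; [lra|]. cbn [omega eps]. rewrite E.
  replace t with (2 * (t / 2)) at 1 by field.
  rewrite cos_2a_cos. ring.
Qed.

(** Here 2 - 2 cos t = 4 sin^2 (t/2), and the complementary angle turns this sine back into a
    cosine. *)
Lemma radical_angle_true (b : list bool) (t : R) :
  radical_angle b t -> radical_angle (true :: b) (PI / 2 - t / 2).
Proof.
  intros H. pose proof (sqrt_omega_angle _ _ H) as E. destruct H as [Ht _].
  split; [lra|]. cbn [omega eps]. rewrite E, cos_shift.
  replace t with (2 * (t / 2)) at 1 by field.
  rewrite cos_2a_sin. ring.
Qed.

(** Since [gray 0 j] is [nil], the reflected recursion also covers length 1, so inductions can start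
    from the empty string. *)
Lemma gray_S (k j : nat) :
  gray (S k) j =
  if Nat.leb j (2 ^ k) then false :: gray k j
  else true :: gray k (2 ^ S k + 1 - j).
Proof. destruct k; reflexivity. Qed.

Lemma radical_angle_gray (k h : nat) : (h < 2 ^ k)%nat ->
  radical_angle (gray k (h + 1)) ((2 * INR h + 1) * PI / 2 ^ (k + 2)).
Proof.
  revert h; induction k as [|k IH]; intros h Hh.
  - replace h with 0%nat by (simpl in Hh; lia).
    replace ((2 * INR 0 + 1) * PI / 2 ^ (0 + 2)) with (PI / 4)
      by (simpl; field).
    exact radical_angle_nil.
  - assert (H2 : 2 ^ k <> 0) by (apply pow_nonzero; lra).
    rewrite gray_S.
    destruct (Nat.leb_spec (h + 1) (2 ^ k)) as [Hle|Hgt].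
    + replace ((2 * INR h + 1) * PI / 2 ^ (S k + 2))
        with ((2 * INR h + 1) * PI / 2 ^ (k + 2) / 2)
        by (rewrite !pow_add; simpl; field; exact H2).
      apply radical_angle_false, IH. lia.
    (* The mirror index of [h]: 2h' + 1 = 2^(k+2) - (2h + 1), so half the angle of [h'] is the
       complement to [PI / 2] of the angle wanted for [h]. *)
    + set (h' := (2 ^ S k - 1 - h)%nat).
      assert (Hsum : (h + h' + 1 = 2 ^ S k)%nat) by (unfold h'; lia).
      replace (2 ^ S k + 1 - (h + 1))%nat with (h' + 1)%nat by lia.
      replace ((2 * INR h + 1) * PI / 2 ^ (S k + 2))
        with (PI / 2 - (2 * INR h' + 1) * PI / 2 ^ (k + 2) / 2).
      * apply radical_angle_true, IH. simpl in Hsum; lia.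
      * apply (f_equal INR) in Hsum.
        rewrite !plus_INR, pow_INR in Hsum.
        change (INR 2) with 2 in Hsum.
        replace (INR h') with (2 * 2 ^ k - INR h - 1)
          by (simpl in Hsum; lra).
        rewrite !pow_add; simpl; field; exact H2.
Qed.

Lemma radical_angle_repeat_false (r : nat) (b : list bool) (t : R) :
  radical_angle b t -> radical_angle (repeat false r ++ b) (t / 2 ^ r).
Proof.
  intros H; induction r as [|r IH].
  - simpl. now replace (t / 1) with t by field.
  - replace (t / 2 ^ S r) with (t / 2 ^ r / 2)
      by (simpl; field; apply pow_nonzero; lra).
    exact (radical_angle_false _ _ IH).
Qed.

Lemma sqrt_omega_gray_tail_string (m h n : nat) :
  (h < 2 ^ m)%nat -> (m + 1 <= n)%nat ->
  sqrt (omega (gray_tail_string m h n)) =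
  2 * sin ((2 * INR h + 1) * PI / 2 ^ (n + 2)).
Proof.
  intros Hh Hn. unfold gray_tail_string.
  rewrite (sqrt_omega_angle _ _
    (radical_angle_true _ _
      (radical_angle_repeat_false (n - m - 1) _ _
        (radical_angle_gray m h Hh)))).
  rewrite cos_shift. do 2 f_equal.
  (* The Gray code part gives the exponent m + 2, the zeros add n - m - 1 halvings, and the leading
     1 adds one more. *)
  replace (n + 2)%nat with (m + 2 + (n - m - 1) + 1)%nat by lia.
  rewrite (pow_add 2 (m + 2 + (n - m - 1)) 1), (pow_add 2 (m + 2)).
  field. split; apply pow_nonzero; lra.
Qed.

Theorem theorem4 (m h : nat) (hm : (1 <= m)%nat) (hh : (h <= 2 ^ m - 1)%nat) :
  is_lim_seq
    (fun n : nat =>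
       2 ^ (n + 1) / (2 * INR h + 1) * sqrt (omega (gray_tail_string m h n)))
    (Finite PI).
Proof.
  assert (Hh : (h < 2 ^ m)%nat)
    by (pose proof (Nat.pow_nonzero 2 m); lia).
  pose proof (pos_INR h). pose proof PI_RGT_0.
  set (x := fun n : nat => (2 * INR h + 1) * PI / 2 ^ (n + 2)).
  assert (Hx : forall n, x n <> 0).
  { intros n. apply Rgt_not_eq, Rdiv_lt_0_compat.
    - apply Rmult_lt_0_compat; lra.
    - apply pow_lt; lra. }
  assert (Lx : is_lim_seq x 0).
  { apply is_lim_seq_ext with
      (fun n => (2 * INR h + 1) * PI / 4 * (/ 2) ^ n).
    - intros n. unfold x. rewrite pow_add, pow_inv. simpl. field.
      apply pow_nonzero; lra.
    - replace (Finite 0)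
        with (Rbar_mult ((2 * INR h + 1) * PI / 4) 0)
        by (simpl; f_equal; ring).
      apply is_lim_seq_scal_l, is_lim_seq_geom.
      rewrite Rabs_pos_eq; lra. }
  (* The prefactor 2^(n+1) / (2h + 1) times 2 is exactly PI / x_n. *)
  apply is_lim_seq_ext_loc with (fun n => PI * (sin (x n) / x n)).
  - exists (m + 1)%nat. intros n Hn.
    rewrite sqrt_omega_gray_tail_string by assumption.
    fold (x n). unfold x at 2. rewrite !pow_add. simpl. field.
    repeat split; try lra. apply pow_nonzero; lra.
  - replace (Finite PI) with (Rbar_mult PI 1) by (simpl; f_equal; ring).
    apply is_lim_seq_scal_l.
    apply (is_lim_comp_seq (fun y => sin y / y) x 0 1).
    + exact is_lim_sinc_0.
    (* The limit of sin y / y at 0 is a punctured one, so the sequence must avoid 0. *)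
    + exists 0%nat. intros n _ E. injection E. apply Hx.
    + exact Lx.
Qed.
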